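(* Let $\{p_\theta:\theta\in(\underline\theta,\overline\theta)\}$ be the exponential family $p_\theta(x)=\exp(\theta x-\kappa(\theta))p_0(x)$ with base density $p_0$, and let $\mu=\kappa'$. Let $x_1,\dots,x_n\in\mathbb{R}$ be data points with $p_0(x_i)>0$ for all $i$, and let $\hat\pi_{\mathrm{NPMLE}}$ be the nonparametric maximum likelihood estimator of the mixing distribution. Fix $x_{\min}\le\min_{1\le i\le n}x_i$ and $x_{\max}\ge\max_{1\le i\le n}x_i$, both in the range of $\mu$, and define $\theta_{\min}=\mu^{-1}(x_{\min})$, $\theta_{\max}=\mu^{-1}(x_{\max})$. Let $r=\frac{\theta_{\max}-\theta_{\min}}{2}$, $a=\frac{x_{\max}-x_{\min}}{2}$, and $x_0=\frac{x_{\max}+x_{\min}}{2}$. Assume that $x_{\min}\le\mu(0)\le x_{\max}$. Then for each $\delta>0$ such that $\delta<\frac15\min\{\theta_{\min}-\underline\theta,\ \overline\theta-\theta_{\max}\}$, $$|\mathrm{supp}(\hat\pi_{\mathrm{NPMLE}})|\le\frac{N_1}{\log\frac{2r+2\delta}{2r+\delta}},$$ where $$N_1=2\,(a+|\mu(0)|+|x_0|)\,(|\theta|_{\max}+2\delta)+\kappa_{\max}+\log\frac{|x|_{\max}+\frac1\delta}{\tau},$$ $$\tau=\max\{\mu(\theta_{\max}+\delta)-x_{\max},\ x_{\min}-\mu(\theta_{\min}-\delta)\},$$ $$|\theta|_{\max}=\max\{\theta_{\max},-\theta_{\min}\},\qquad |x|_{\max}=\max\{x_{\max},-x_{\min}\},$$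 $$\kappa_{\max}=\max\{\kappa(\theta_{\min}-3\delta),\ \kappa(\theta_{\max}+3\delta)\}.$$
   Context: Let $p_0$ be a probability density on $\mathbb{R}$ with respect to Lebesgue measure (a ''continuous'' exponential family), with moment generating function $L(\theta)=\mathbb{E}_{X\sim p_0}[e^{\theta X}]$ and cumulant generating function $\kappa(\theta)=\log L(\theta)$, assumed finite for all $\theta\in(\underline\theta,\overline\theta)$, where $\underline\theta,\overline\theta\in[-\infty,\infty]$ and $0\in(\underline\theta,\overline\theta)$. Then $\kappa$ is strictly convex on $(\underline\theta,\overline\theta)$ and $\mu(\theta)=\kappa'(\theta)=L'(\theta)/L(\theta)$ is strictly increasing, so $\mu^{-1}$ is well defined on the range of $\mu$. For a probability measure $\pi$ on the parameter space $\Theta=(\underline\theta,\overline\theta)$, the mixture density is $p_\pi(x)=\int_\Theta p_\theta(x)\,\pi(d\theta)$. The nonparametric maximum likelihood estimator (NPMLE) $\hat\pi_{\mathrm{NPMLE}}$ based on $x_1,\dots,x_n$ is a maximizer of $\pi\mapsto\frac1n\sum_{i=1}^n\log p_\pi(x_i)$ over all probability measures $\pi$ on $\Theta$. $|\mathrm{supp}(\cdot)|$ denotes the number of atoms (mass points). *)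

(* Defs.v *)
From HB Require Import structures.
From mathcomp Require Import all_boot all_order all_algebra.
From mathcomp Require Import all_classical all_reals all_analysis measurable_realfun.

Set Implicit Arguments.
Unset Strict Implicit.
Unset Printing Implicit Defensive.

Import Order.TTheory GRing.Theory Num.Theory.
Import numFieldNormedType.Exports.

Local Open Scope classical_set_scope.
Local Open Scope ring_scope.

Section exponential_family.
Context {R : realType}.
Implicit Types (lo hi : \bar R) (t x : R).

Definition is_density (p0 : R -> R) :=
  [/\ measurable_fun [set: R] p0, forall x, 0 <= p0 x
    & (\int[lebesgue_measure]_x (p0 x)%:E = 1)%E].

Definition Theta lo hi : set R := [set t | (lo < t%:E < hi)%E].

Definition mgf (p0 : R -> R) t : \bar R :=
  (\int[lebesgue_measure]_x (expR (t * x) * p0 x)%:E)%E.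

Definition cgf (p0 : R -> R) t : R := ln (fine (mgf p0 t)).

Definition mean_map (p0 : R -> R) : R -> R := derive1 (cgf p0).

Definition expfam (p0 : R -> R) t x : R := expR (t * x - cgf p0 t) * p0 x.

End exponential_family.

Section mixtures.
Context {R : realType}.
Implicit Types (lo hi : \bar R) (pi : probability (measurableTypeR R) R).

(* A mixing distribution is a Borel probability on R carried by Theta lo hi.
   The mixture density and log-likelihood take extended real values, so that
   no integrability condition restricts the competing mixing distributions. *)
Definition mixing lo hi pi := (pi (Theta lo hi) = 1)%E.

Definition mixture (p0 : R -> R) lo hi pi (x : R) : \bar R :=
  (\int[pi]_(t in Theta lo hi) (expfam p0 t x)%:E)%E.

Definition avg_loglik (p0 : R -> R) lo hi n (x : 'I_n -> R) pi : \bar R :=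
  ((n%:R^-1)%:E * \sum_(i < n) lne (mixture p0 lo hi pi (x i)))%E.

Definition is_npmle (p0 : R -> R) lo hi n (x : 'I_n -> R) pi :=
  mixing lo hi pi /\
  forall pi' : probability (measurableTypeR R) R, mixing lo hi pi' ->
    (avg_loglik p0 lo hi x pi' <= avg_loglik p0 lo hi x pi)%E.

(* Topological support.  By supp_atoms below, once it is finite it is exactly
   the set of atoms; unlike the latter it also detects diffuse mass. *)
Definition supp pi : set R :=
  [set t | forall U : set R, open U -> U t -> (0 < pi U)%E].

Lemma setC_supp_null pi : pi.-negligible (~` supp pi).
Proof.
pose B (k : rat * rat) : set R := ball (ratr k.1 : R) (ratr k.2 : R).
pose W (n : nat) : set R := if unpickle n is Some k then
  (if pi (B k) == 0%E then B k else set0) else set0.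
have mB k : measurable (B k : set (measurableTypeR R)).
  exact: measurable_ball.
have Wn n : pi.-negligible (W n).
  rewrite /W; case: (unpickle n) => [k|]; last exact: negligible_set0.
  case: eqP => [B0|_]; last exact: negligible_set0.
  exact/negligibleP.
apply: negligibleS (negligible_bigcup Wn).
move=> t /= /existsNP [U] /not_implyP [oU] /not_implyP [Ut] /negP.
rewrite -leNgt => U0.
have [c [r [tB BU]]] : exists c r : rat, B (c, r) t /\ B (c, r) `<=` U.
  have [c [r [tB BU]]] := open_subball_rat oU (mem_set Ut).
  by exists c, r; split => //; exact: set_mem.
exists (pickle (c, r)); first exact: I.
rewrite /W pickleK; case: eqP => // /eqP; rewrite eq_le measure_ge0 andbT.
rewrite (le_trans _ U0)//; apply: le_measure; rewrite ?inE//.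
exact: open_measurable.
Qed.

Lemma supp_atoms pi :
  finite_set (supp pi) -> supp pi = [set t | (0 < pi [set t])%E].
Proof.
move=> fS; apply/seteqP; split => [t St|t /= t0 U oU Ut]; last first.
  rewrite (lt_le_trans t0)//; apply: le_measure; rewrite ?inE//.
  - exact: open_measurable.
  - by move=> _ ->.
have [N [mN N0 SN]] := setC_supp_null pi.
pose U : set R := ~` (supp pi `\ t).
have oU : open U.
  rewrite openC; have /accessible_finite_set_closed : accessible_space R.
    exact/hausdorff_accessible/Rhausdorff.
  by apply; exact: finite_setD.
have /= := St U oU; have Ut : U t by move=> [_]; apply.
move=> /(_ Ut) U0; rewrite (lt_le_trans U0)//.
have -> : (pi [set t] = pi [set t] + pi N)%E by rewrite N0 adde0.
rewrite (le_trans _ (measureU2 _ _ _))//; apply: le_measure; rewrite ?inE//.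
- exact: open_measurable.
- exact: measurableU.
- move=> y Uy; have [->|yt] := eqVneq y t; first by left.
  by right; apply: SN => Sy; apply: Uy; split => //=; apply/eqP.
Qed.

End mixtures.

(* Main.v *)
(* By first-order optimality, the atoms of the NPMLE are contact points of
   S(t) = sum_i w_i e^(t x_i) <= L(t) for suitable weights w_i > 0, where L is
   the moment generating function; hence S = L and S' = L' there, and they all
   lie in [tmin, tmax].  After the shift y |-> y - xmin, take the Lagrange
   interpolation of t |-> y e^(t y) at an even number N of atoms b_j and
   evaluate its remainder at c = tmax + delta.  The remainder is <= 0 for y < 0,
   >= 0 at the (shifted) data points, and for y > 0 at most
   prod_j (c - b_j) / (c + delta - b_j) * y e^((c + delta) y).  Integrating it
   against p0 and subtracting the data sum leaves (L - S)'(c), which is at least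
   tau L(c); this gives tau L(c) <= rho^N L(c + 2 delta) / (e delta), up to the
   shift, with rho = (2 r + delta) / (2 r + 2 delta).  The factor 1/e pays for
   the atom dropped to make N even.  The same argument at tmin - delta, with
   y |-> xmax - y, handles the other term of the maximum tau. *)

Require Import Defs.
From HB Require Import structures.
From mathcomp Require Import all_boot all_order all_algebra.
From mathcomp Require Import finmap.
From mathcomp Require Import all_classical all_reals all_analysis measurable_realfun.
From mathcomp Require Import ring lra.
Import Order.TTheory GRing.Theory Num.Theory.
Import numFieldNormedType.Exports.
Local Open Scope classical_set_scope.
Local Open Scope ring_scope.

Set Implicit Arguments.
Unset Strict Implicit.
Unset Printing Implicit Defensive.

(** * Lagrange interpolation of exponentials *)

Lemma le_is_derive (R : realType) (f f' : R -> R) (a b : R) :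
    (forall x : R, is_derive x 1 f (f' x)) -> a <= b ->
    (forall x, a <= x <= b -> 0 <= f' x) ->
  f a <= f b.
Proof.
move=> df ab f'0; apply: (@ger0_derive1_ndecr _ f a b) => //.
- move=> x; rewrite in_itv/= => /andP[ax xb].
  by rewrite derive1E derive_val f'0// !ltW.
- apply: continuous_subspaceT => x; apply: differentiable_continuous.
  exact/derivable1_diffP.
Qed.

Lemma is_derive_expRM (R : realType) (b x : R) :
  is_derive x 1 (fun y => expR (b * y)) (b * expR (b * x)).
Proof.
have db : is_derive x 1 (fun y => b * y) b.
  by apply: is_derive_eq; rewrite /GRing.scale/= mulr1.
by apply: is_derive_eq; rewrite /GRing.scale/= mulrC.
Qed.

Lemma is_derive_exp_sum (R : realType) (I : Type) (r : seq I) (l m : I -> R) (x : R) :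
  is_derive x 1 (fun y => \sum_(i <- r) l i * expR (m i * y))
    (\sum_(i <- r) l i * (m i * expR (m i * x))).
Proof.
elim: r => [|i r ih].
  under eq_fun do rewrite big_nil.
  by rewrite big_nil; exact: is_derive_cst.
under eq_fun do rewrite big_cons.
rewrite big_cons.
have := is_derive_expRM (m i) x.
by move=> di; apply: is_derive_eq.
Qed.

(* [expR (c * y)] minus the right-hand sum is the remainder at [c] of the
   Lagrange interpolation of [t |-> expR (t * y)] at the nodes [bs]. *)
Lemma exp_interpolation (R : realType) (bs : seq R) (c p rho : R) :
    0 < p -> uniq bs ->
    (forall b, b \in bs -> b < c /\ c - b <= rho * (c + p - b)) ->
  exists lam : R -> R,
    let Psi (y : R) := expR (c * y) - \sum_(b <- bs) lam b * expR (b * y) in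
    (forall y : R, 0 <= y ->
       0 <= Psi y <= rho ^+ size bs * expR ((c + p) * y)) /\
    (forall y : R, y <= 0 -> 0 <= (-1) ^+ size bs * Psi y).
Proof.
move=> p0; elim: bs => [_ _|b0 bs ih /= /andP[b0bs ubs] hbs].
  exists (fun=> 0) => /=; split => y y0; rewrite big_nil subr0 expr0 mul1r expR_ge0//=.
  by rewrite ler_expR ler_wpM2r// lerDl ltW.
have [b|lam [ihp ihn]] := ih ubs; first by move=> bbs; apply: hbs; rewrite inE bbs orbT.
have [b0c rhob0] : b0 < c /\ c - b0 <= rho * (c + p - b0) by apply: hbs; rewrite inE eqxx.
have rho0 : 0 <= rho.
  have := rhob0; rewrite leNgt; apply: contraNP => /negP; rewrite -ltNge => r0.
  by rewrite (@lt_trans _ _ 0) ?subr_gt0// nmulr_rlt0// subr_gt0 ltr_wpDr ?ltW.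
(* Adding the node [b0] amounts to one integration: the new remainder divided by [expR (b0 * y)] is
   [F], the antiderivative of [(c - b0) * expR (- b0 * y) * Psi y] that vanishes at 0. Integrating
   term by term produces [lam1], and [l0] is the constant of integration. *)
pose lam1 b := lam b * (c - b0) / (b - b0).
pose l0 := 1 - \sum_(b <- bs) lam1 b.
pose F y := expR ((c - b0) * y) - \sum_(b <- bs) lam1 b * expR ((b - b0) * y) - l0.
pose Psi y := expR (c * y) - \sum_(b <- bs) lam b * expR (b * y).
have dF (x : R) : is_derive x 1 F ((c - b0) * (expR (- b0 * x) * Psi x)).
  have := is_derive_expRM (c - b0) x.
  have := is_derive_exp_sum bs lam1 (fun b => b - b0) x => d1 d2.
  apply: is_derive_eq; rewrite subr0 /Psi mulrBr -expRD [in RHS]mulrBr.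
  congr (_ - _); first by congr (_ * expR _); ring.
  rewrite !mulr_sumr !big_seq; apply: eq_bigr => b bbs.
  have bb0 : b - b0 != 0 by rewrite subr_eq0; apply: contraNneq b0bs => <-.
  rewrite mulrA /lam1 divfK// [in RHS](mulrCA (expR _)) -expRD mulrA (mulrC (lam b)).
  by congr (_ * expR _); ring.
have F0 : F 0 = 0.
  rewrite /F mulr0 expR0 /l0; under eq_bigr do rewrite mulr0 expR0 mulr1.
  by rewrite subrr.
exists (fun b => if b == b0 then l0 else lam1 b) => /=.
have PsiF y : expR (c * y) -
    \sum_(b <- b0 :: bs) (if b == b0 then l0 else lam1 b) * expR (b * y) =
    expR (b0 * y) * F y.
  rewrite big_cons eqxx /F mulrBr mulrBr -expRD mulr_sumr opprD addrA addrAC.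
  congr (_ - _ - _); [congr expR; ring| |ring].
  rewrite !big_seq; apply: eq_bigr => b bbs.
  rewrite ifF; last by apply: contraNF b0bs => /eqP <-.
  by rewrite mulrCA -expRD; congr (_ * expR _); ring.
split => y y0; rewrite PsiF.
- apply/andP; split.
    rewrite mulr_ge0 ?expR_ge0// -F0; apply: le_is_derive => // x /andP[x0 _].
    rewrite mulr_ge0 ?subr_ge0 ?(ltW b0c)// mulr_ge0 ?expR_ge0//.
    by have /andP[] := ihp _ x0.
  (* The upper bound follows by comparing derivatives on [[0, y]]. Differentiating the majorant
     brings down [c + p - b0], and [c - b0 <= rho * (c + p - b0)] is what earns the extra factor
     [rho]. *)
  pose G y := rho ^+ (size bs).+1 * expR ((c + p - b0) * y) - F y.
  have : 0 <= G y.
    apply: (@le_trans _ _ (G 0)); first by rewrite /G F0 mulr0 expR0 mulr1 subr0 exprn_ge0.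
    have dG (x : R) : is_derive x 1 G
        (rho ^+ (size bs).+1 * ((c + p - b0) * expR ((c + p - b0) * x)) -
         (c - b0) * (expR (- b0 * x) * Psi x)).
      have := is_derive_expRM (c + p - b0) x => d1.
      by apply: is_derive_eq; rewrite /GRing.scale/= ?mulr0 ?addr0 ?add0r.
    apply: le_is_derive => // x /andP[x0 _]; rewrite subr_ge0.
    have /andP[_ Px] := ihp _ x0.
    apply: (@le_trans _ _ ((c - b0) *
      (expR (- b0 * x) * (rho ^+ size bs * expR ((c + p) * x))))).
      by rewrite ler_wpM2l ?subr_ge0 ?(ltW b0c)// ler_wpM2l ?expR_ge0.
    rewrite [X in _ * X]mulrCA -expRD.
    rewrite (_ : - b0 * x + (c + p) * x = (c + p - b0) * x); last by ring.
    rewrite mulrCA exprSr -mulrA ler_wpM2l ?exprn_ge0// [leRHS]mulrA.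
    by rewrite ler_wpM2r ?expR_ge0.
  rewrite /G subr_ge0 => FG.
  apply: (@le_trans _ _ (expR (b0 * y) * (rho ^+ (size bs).+1 * expR ((c + p - b0) * y)))).
    by rewrite ler_wpM2l ?expR_ge0.
  rewrite mulrCA -expRD (_ : b0 * y + _ = (c + p) * y)//; ring.
(* To the left of 0 the integration runs backwards from [F 0 = 0], so each node flips the sign. *)
- rewrite mulrCA mulr_ge0 ?expR_ge0// exprS mulN1r mulNr oppr_ge0.
  rewrite -[leRHS](mulr0 ((-1) ^+ size bs)) -F0.
  have d2 (x : R) : is_derive x 1 (fun y => (-1) ^+ size bs * F y)
      ((-1) ^+ size bs * ((c - b0) * (expR (- b0 * x) * Psi x))).
    by apply: is_derive_eq; rewrite /GRing.scale/= ?mulr0 ?addr0.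
  apply: (le_is_derive d2) => // x /andP[_ x0].
  rewrite mulrCA mulr_ge0 ?subr_ge0 ?(ltW b0c)// mulrCA mulr_ge0 ?expR_ge0//.
  exact: ihn.
Qed.

(** * Moment generating functions *)

Section weighted_integral.
Context (R : realType) (p0 : R -> R) (hp0 : is_density p0).
Implicit Types f g : R -> R.

Definition pintegrable f :=
  (@lebesgue_measure R).-integrable setT (EFin \o (fun y => f y * p0 y)).

Definition pint f : R := (\int[@lebesgue_measure R]_y (f y * p0 y))%R.

Lemma pintegrableD f g : pintegrable f -> pintegrable g ->
  pintegrable (fun y => f y + g y).
Proof.
move=> If Ig; have := integrableD measurableT If Ig.
by apply: eq_integrable => // y _ /=; rewrite mulrDl.
Qed.

Lemma pintegrableZ (k : R) f : pintegrable f -> pintegrable (fun y => k * f y).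
Proof.
move=> If; have := integrableZl measurableT k If.
by apply: eq_integrable => // y _ /=; rewrite -EFinM mulrA.
Qed.

Lemma pintegrable_sum (I : eqType) (s : seq I) (h : I -> R -> R) :
    (forall i, i \in s -> pintegrable (h i)) ->
  pintegrable (fun y => \sum_(i <- s) h i y).
Proof.
elim: s => [_|i s ih hs].
  apply: eq_integrable (integrable0 (@lebesgue_measure R) setT) => // y _ /=.
  by rewrite big_nil mul0r.
under [X in pintegrable X]eq_fun do rewrite big_cons.
apply: pintegrableD; first by apply: hs; rewrite mem_head.
by apply: ih => j js; apply: hs; rewrite inE js orbT.
Qed.

Lemma pintD f g : pintegrable f -> pintegrable g ->
  pint (fun y => f y + g y) = pint f + pint g.
Proof.
move=> If Ig; rewrite /pint -RintegralD//.
by apply: eq_Rintegral => y _; rewrite mulrDl.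
Qed.

Lemma pintZ (k : R) f : pintegrable f -> pint (fun y => k * f y) = k * pint f.
Proof.
move=> If; rewrite /pint -RintegralZl//.
by apply: eq_Rintegral => y _; rewrite mulrA.
Qed.

Lemma pint_sum (I : eqType) (s : seq I) (h : I -> R -> R) :
    (forall i, i \in s -> pintegrable (h i)) ->
  pint (fun y => \sum_(i <- s) h i y) = \sum_(i <- s) pint (h i).
Proof.
elim: s => [_|i s ih hs].
  rewrite big_nil /pint; under eq_Rintegral do rewrite big_nil mul0r.
  by rewrite Rintegral_cst// mul0r.
rewrite big_cons; under [X in pint X]eq_fun do rewrite big_cons.
have hs' j : j \in s -> pintegrable (h j) by move=> js; apply: hs; rewrite inE js orbT.
rewrite pintD ?ih//; first by apply: hs; rewrite mem_head.
exact: pintegrable_sum.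
Qed.

Lemma le_pint f g : pintegrable f -> pintegrable g -> (forall y, f y <= g y) ->
  pint f <= pint g.
Proof.
have [_ p0ge0 _] := hp0.
by move=> If Ig fg; apply: le_Rintegral => // y _; rewrite ler_wpM2r.
Qed.

Lemma le_pintegrable f g : measurable_fun setT f ->
  (forall y, `|f y| <= g y) -> pintegrable g -> pintegrable f.
Proof.
have [mp p0ge0 _] := hp0.
move=> mf fg; apply: le_integrable => //.
  by apply/measurable_EFinP; exact: measurable_funM.
move=> y _ /=; rewrite lee_fin !normrM ler_wpM2r//.
by rewrite (le_trans (fg y))// ler_norm.
Qed.

(** If the integral were 0, then [f * p0] would vanish almost everywhere. Since [{m}] is a null set
    and [f] is positive off it, [p0] itself would vanish almost everywhere, against its total mass
    1. *)
Lemma pint_gt0 f (m : R) : pintegrable f -> (forall y, 0 <= f y) ->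
  (forall y, y != m -> 0 < f y) -> 0 < pint f.
Proof.
have [mp p0ge0 p01] := hp0.
move=> If f0 fm; rewrite lt_neqAle; apply/andP; split; last first.
  by apply: Rintegral_ge0 => y _; rewrite mulr_ge0.
apply/eqP => /esym f00.
have mfp : measurable_fun setT (fun y => (f y * p0 y)%:E).
  exact: measurable_int If.
have : (\int[@lebesgue_measure R]_y `|(f y * p0 y)%:E| = 0)%E.
  transitivity (\int[@lebesgue_measure R]_y (f y * p0 y)%:E)%E.
    by apply: eq_integral => y _; rewrite /= ger0_norm// mulr_ge0.
  apply/eqP; rewrite -fine_eq0; first exact/eqP.
  exact: integrable_fin_num.
move=> /ae_eq_integral_abs -/(_ measurableT mfp) fp0.
have : ae_eq (@lebesgue_measure R) setT (EFin \o p0) (cst 0%E).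
  have mNm : (@lebesgue_measure R).-negligible [set m].
    by apply/negligibleP => //; exact: lebesgue_measure_set1.
  apply: negligibleS (negligibleU fp0 mNm) => y /= hy.
  have [->|ym] := eqVneq y m; [by right|left => h; apply: hy => _].
  have /eqP := h I; rewrite eqe mulf_eq0 => /orP[|/eqP -> //].
  by rewrite gt_eqF// fm.
move=> /ae_eq_integral -/(_ measurableT).
rewrite p01 integral0 => /(_ _ _)/eqP; rewrite onee_eq0 => H.
by apply/notF/H => //; exact/measurable_EFinP.
Qed.

End weighted_integral.

Lemma open_Theta (R : realType) (lo hi : \bar R) (t : R) :
  Theta lo hi t -> exists2 e : R, 0 < e & forall s, `|s - t| <= e -> Theta lo hi s.
Proof.
move=> /andP[lot thi].
have [a a0 ha] : exists2 a : R, 0 < a & forall s, t - a <= s -> (lo < s%:E)%E.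
  case: lo lot => [l|//|] lt.
  - rewrite lte_fin in lt; exists ((t - l) / 2); first by rewrite divr_gt0// subr_gt0.
    by move=> s hs; rewrite lte_fin; lra.
  - by exists 1 => // s _; rewrite ltNyr.
have [b b0 hb] : exists2 b : R, 0 < b & forall s, s <= t + b -> (s%:E < hi)%E.
  case: hi thi => [h||//] th.
  - rewrite lte_fin in th; exists ((h - t) / 2); first by rewrite divr_gt0// subr_gt0.
    by move=> s hs; rewrite lte_fin; lra.
  - by exists 1 => // s _; rewrite ltry.
exists (Num.min a b); first by rewrite lt_min a0.
move=> s; rewrite le_min => /andP[]; rewrite !ler_norml => /andP[? ?] /andP[? ?].
by rewrite /Theta/= ha ?hb//; lra.
Qed.

Lemma open_set_Theta (R : realType) (lo hi : \bar R) : open (Theta lo hi).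
Proof.
rewrite openE => t /open_Theta[e e0 he]; exists e => //= s.
by rewrite /ball_/= distrC => /ltW/he.
Qed.

Lemma norm_le_expR (R : realType) (e y : R) : 0 < e -> `|y| <= e^-1 * expR (e * `|y|).
Proof.
move=> e0; rewrite ler_pdivlMl// (le_trans _ (expR_ge1Dx _))//.
by rewrite lerDr.
Qed.

Section mgf.
Context (R : realType) (p0 : R -> R) (hp0 : is_density p0) (lo hi : \bar R).
Hypothesis hmgf : forall t : R, Theta lo hi t -> (mgf p0 t < +oo)%E.

(** By definition [fine (mgf p0 t)], so that [cgf p0 t] unfolds to [ln (rmgf t)]; [rmgf'] is the
    integral obtained by formally differentiating under the sign. *)
Definition rmgf (t : R) := pint p0 (fun y => expR (t * y)).
Definition rmgf' (t : R) := pint p0 (fun y => y * expR (t * y)).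

Let measurable_expRM (t : R) : measurable_fun setT (fun y : R => expR (t * y)).
Proof. by apply: measurableT_comp => //; exact: mulrl_measurable. Qed.

Lemma pintegrable_expR t : Theta lo hi t -> pintegrable p0 (fun y => expR (t * y)).
Proof.
have [mp p0ge0 _] := hp0.
move=> /hmgf ht; apply/integrableP; split.
  by apply/measurable_EFinP; apply: measurable_funM (measurable_expRM t) mp.
apply: le_lt_trans ht; rewrite le_eqVlt; apply/orP; left; apply/eqP.
by apply: eq_integral => y _; rewrite /= ger0_norm// mulr_ge0 ?expR_ge0.
Qed.

(** A majorant independent of [s]: the factor [|y|] costs one [e] in the exponent, moving from [s]
    to [t] another, and the two signs of [y] are covered by adding both exponentials. It serves both
    integrability and differentiation under the integral. *)
Lemma norm_mul_expR_le (t s e y : R) : 0 < e -> `|s - t| <= e ->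
  `|y * expR (s * y)| <= e^-1 * (expR ((t + 2 * e) * y) + expR ((t - 2 * e) * y)).
Proof.
move=> e0 st; rewrite normrM (ger0_norm (expR_ge0 _)).
apply: (@le_trans _ _ (e^-1 * expR (e * `|y|) * expR (s * y))).
  by rewrite ler_wpM2r ?expR_ge0// norm_le_expR.
rewrite -mulrA -expRD ler_wpM2l ?invr_ge0 ?(ltW e0)//.
have : (s - t) * y <= e * `|y|.
  by rewrite (le_trans (ler_norm _))// normrM ler_wpM2r.
have [y0|y0] := leP 0 y => h.
  apply: ler_wpDr; rewrite ?expR_ge0// ler_expR.
  by rewrite ger0_norm// in h *; lra.
apply: ler_wpDl; rewrite ?expR_ge0// ler_expR.
by rewrite ltr0_norm// in h *; lra.
Qed.

Lemma pintegrable_mul_expR t : Theta lo hi t ->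
  pintegrable p0 (fun y => y * expR (t * y)).
Proof.
move=> /open_Theta[e e0 he].
have e20 : 0 < e / 2 by rewrite divr_gt0.
apply: (@le_pintegrable _ _ hp0 _ (fun y => (e / 2)^-1 *
    (expR ((t + 2 * (e / 2)) * y) + expR ((t - 2 * (e / 2)) * y)))).
- exact: measurable_funM (measurable_expRM t).
- by move=> y; apply: norm_mul_expR_le; rewrite // subrr normr0 ltW.
- apply: pintegrableZ; apply: pintegrableD; apply: pintegrable_expR; apply: he.
    by rewrite addrC addKr gtr0_norm; lra.
  by rewrite addrC addKr normrN gtr0_norm; lra.
Qed.

Lemma is_derive_rmgf t : Theta lo hi t -> is_derive t 1 rmgf (rmgf' t).
Proof.
have [mp p0ge0 _] := hp0.
move=> /open_Theta[e e0 he].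
(* Halving [e] keeps the two exponents of the dominating function [G], at distance [2 * (e / 2)]
   from [t], inside [Theta lo hi]. *)
have e20 : 0 < e / 2 by rewrite divr_gt0.
pose f (s y : R) := expR (s * y) * p0 y.
pose G (y : R) := (e / 2)^-1 *
  (expR ((t + 2 * (e / 2)) * y) + expR ((t - 2 * (e / 2)) * y)) * p0 y.
have dh (s y : R) : is_derive s 1 (f ^~ y) (y * expR (s * y) * p0 y).
  have d1 : is_derive s 1 (fun s => expR (s * y)) (y * expR (s * y)).
    under eq_fun do rewrite mulrC.
    by rewrite (mulrC s); exact: is_derive_expRM.
  rewrite /f.
  have -> : (fun s => expR (s * y) * p0 y) = (fun s => p0 y * expR (s * y)).
    by apply/funext => z; rewrite mulrC.
  by apply: is_derive_eq; rewrite /GRing.scale/= mulrC.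
have Ie s : `]t - e / 2, t + e / 2[%classic s -> `|s - t| <= e / 2.
  by rewrite /= in_itv/= ler_norml => /andP[? ?]; apply/andP; split; lra.
have It : `]t - e / 2, t + e / 2[%classic t by rewrite /= in_itv/=; apply/andP; split; lra.
have intf s : `]t - e / 2, t + e / 2[%classic s ->
    (@lebesgue_measure R).-integrable setT (EFin \o f s).
  move=> /Ie hs; apply: pintegrable_expR; apply: he; lra.
have derf s y : `]t - e / 2, t + e / 2[%classic s -> setT y -> derivable (f ^~ y) s 1.
  by move=> _ _; exact: ex_derive.
have G0 y : 0 <= G y.
  by rewrite mulr_ge0// mulr_ge0 ?invr_ge0 ?ltW// addr_gt0 ?expR_gt0.
have intG : (@lebesgue_measure R).-integrable setT (EFin \o G).
  apply: pintegrableZ; apply: pintegrableD; apply: pintegrable_expR; apply: he.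
    by rewrite addrC addKr gtr0_norm; lra.
  by rewrite addrC addKr normrN gtr0_norm; lra.
have Gub s y : `]t - e / 2, t + e / 2[%classic s -> setT y ->
    `|partial1of2 f s y| <= G y.
  move=> /Ie hs _; rewrite partial1of2E derive_val normrM (ger0_norm (p0ge0 y)).
  by rewrite ler_wpM2r// norm_mul_expR_le.
have := differentiation_under_integral measurableT It intf derf G0 intG Gub.
have := derivable_under_integral measurableT It intf derf G0 intG Gub.
move=> h1 h2; apply: DeriveDef => //; rewrite -derive1E h2.
by apply: eq_Rintegral => y _; rewrite partial1of2E derive_val.
Qed.

Lemma rmgf_gt0 t : Theta lo hi t -> 0 < rmgf t.
Proof.
move=> ht; apply: (@pint_gt0 _ _ hp0 _ 0); first exact: pintegrable_expR.
- by move=> y; exact: expR_ge0.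
- by move=> y _; exact: expR_gt0.
Qed.

Lemma is_derive_cgf t : Theta lo hi t -> is_derive t 1 (cgf p0) (rmgf' t / rmgf t).
Proof.
move=> ht; have d1 := is_derive_rmgf ht.
have d2 := is_derive1_ln (rmgf_gt0 ht).
by rewrite mulrC; exact: (@is_derive1_comp _ (@ln R) rmgf).
Qed.

Lemma mean_mapE t : Theta lo hi t -> mean_map p0 t = rmgf' t / rmgf t.
Proof.
by move=> /is_derive_cgf d; rewrite /mean_map derive1E derive_val.
Qed.

End mgf.

(** * Convexity of the cumulant generating function *)

Section mean_value_map.
Context (R : realType) (p0 : R -> R) (hp0 : is_density p0) (lo hi : \bar R).
Hypothesis hmgf : forall t : R, Theta lo hi t -> (mgf p0 t < +oo)%E.

Lemma cgfE (t : R) : cgf p0 t = ln (rmgf p0 t).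
Proof. by []. Qed.

Let rmgf_neq0 t : Theta lo hi t -> rmgf p0 t != 0.
Proof. by move=> ht; rewrite gt_eqF// (rmgf_gt0 hp0 hmgf). Qed.

(** Jensen's inequality for the tilted density at [t], with no second derivative: integrate
    [1 + u <= expR u] at [u = (s - t) * (y - m)] against [expR (t * y) * p0 y]. The linear term
    drops out because [m] is the tilted mean. *)
Lemma cgf_tangent_le t s : Theta lo hi t -> Theta lo hi s ->
  cgf p0 t + mean_map p0 t * (s - t) <= cgf p0 s.
Proof.
move=> ht hs; set m := mean_map p0 t.
have Lt := rmgf_gt0 hp0 hmgf ht; have Ls := rmgf_gt0 hp0 hmgf hs.
have mL : rmgf' p0 t = m * rmgf p0 t.
  by rewrite /m (mean_mapE hp0 hmgf ht) divfK// rmgf_neq0.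
have It := pintegrable_expR hp0 hmgf ht.
have It' := pintegrable_mul_expR hp0 hmgf ht.
pose E := expR ((s - t) * m).
have : pint p0 (fun y => E * (1 - (s - t) * m) * expR (t * y) +
                         E * (s - t) * (y * expR (t * y)))
    <= rmgf p0 s.
  apply: le_pint => //; first by apply: pintegrableD; exact: pintegrableZ.
    exact: (pintegrable_expR hp0 hmgf hs).
  move=> y; have -> : s * y = (s - t) * m + t * y + (s - t) * (y - m) by ring.
  rewrite !expRD -/E.
  have := expR_ge1Dx ((s - t) * (y - m)).
  move=> /(ler_wpM2l (mulr_ge0 (expR_ge0 ((s - t) * m)) (expR_ge0 (t * y)))).
  by rewrite -/E; apply: le_trans; rewrite le_eqVlt; apply/orP; left; apply/eqP; ring.
rewrite pintD ?pintZ//; [|exact: pintegrableZ..].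
rewrite -/(rmgf p0 t) -/(rmgf' p0 t) mL.
have -> : E * (1 - (s - t) * m) * rmgf p0 t +
    E * (s - t) * (m * rmgf p0 t) = E * rmgf p0 t by ring.
move=> h; rewrite !cgfE -[X in _ + X]expRK -lnM ?posrE ?expR_gt0//.
by rewrite ler_ln ?posrE ?mulr_gt0 ?expR_gt0// mulrC (mulrC m).
Qed.

(** The function [(y - m) * (expR (s * y) - expR ((s - t) * m + t * y))] is positive except at
    [y = m], as both factors change sign there. In its integral the second exponential contributes
    0, since [m] is the mean at [t], so [rmgf' s - m * rmgf s] is positive. *)
Lemma mean_map_lt t s : Theta lo hi t -> Theta lo hi s -> t < s ->
  mean_map p0 t < mean_map p0 s.
Proof.
move=> ht hs ts; set m := mean_map p0 t.
have Ls := rmgf_gt0 hp0 hmgf hs.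
have mL : rmgf' p0 t = m * rmgf p0 t.
  by rewrite /m (mean_mapE hp0 hmgf ht) divfK// rmgf_neq0.
have It := pintegrable_expR hp0 hmgf ht.
have It' := pintegrable_mul_expR hp0 hmgf ht.
have Is := pintegrable_expR hp0 hmgf hs.
have Is' := pintegrable_mul_expR hp0 hmgf hs.
rewrite (mean_mapE hp0 hmgf hs) ltr_pdivlMr//.
pose E := expR ((s - t) * m).
pose f (y : R) := y * expR (s * y) + (- m * expR (s * y)) +
  ((- E) * (y * expR (t * y)) + E * m * expR (t * y)).
have fE y : f y = (y - m) * (expR (s * y) - expR ((s - t) * m + t * y)).
  by rewrite /f expRD -/E; ring.
have If : pintegrable p0 f.
  by apply: pintegrableD; apply: pintegrableD => //; exact: pintegrableZ.
have fm y : y != m -> 0 < f y.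
  rewrite fE neq_lt => /orP[ym|my].
    by rewrite nmulr_rgt0 subr_lt0// ltr_expR -subr_gt0;
      have := mulr_gt0 (etrans (subr_gt0 t s) ts) (etrans (subr_gt0 y m) ym); lra.
  by rewrite pmulr_rgt0 subr_gt0// ltr_expR -subr_gt0;
    have := mulr_gt0 (etrans (subr_gt0 t s) ts) (etrans (subr_gt0 m y) my); lra.
have : 0 < pint p0 f.
  apply: (@pint_gt0 _ _ hp0 _ m) => // y.
  by have [->|/fm/ltW//] := eqVneq y m; rewrite fE subrr mul0r.
rewrite /f !pintD ?pintZ//; [|try (by apply: pintegrableZ)..].
- rewrite -/(rmgf p0 t) -/(rmgf' p0 t) -/(rmgf p0 s) -/(rmgf' p0 s) mL.
  by lra.
- by apply: pintegrableD => //; exact: pintegrableZ.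
- by apply: pintegrableD; exact: pintegrableZ.
Qed.

End mean_value_map.

(** * The interpolation remainder integrated against the base density *)

Lemma mul_expR_le (R : realType) (d y : R) : 0 < d ->
  y <= d^-1 * expR (- 1) * expR (d * y).
Proof.
move=> d0; rewrite -mulrA -expRD ler_pdivlMl//.
by rewrite (le_trans _ (expR_ge1Dx _))// addrA subrr add0r.
Qed.

Section interpolation_bound.
Context (R : realType) (p0 : R -> R) (hp0 : is_density p0) (lo hi : \bar R).
Hypothesis hmgf : forall t : R, Theta lo hi t -> (mgf p0 t < +oo)%E.
Context (n : nat) (x w : 'I_n -> R) (w0 : forall i, 0 <= w i).

Definition expsum (t : R) := \sum_(i < n) w i * expR (t * x i).
Definition expsum' (t : R) := \sum_(i < n) w i * (x i * expR (t * x i)).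

(** The sign [sg] treats both ends at once: everything is written in the coordinate
    [Y y = sg * (y - xb)], in which all data points are nonnegative. The left side is the integral
    of [h c] minus its weighted data sum. Replacing [h c] by [Y * Psi] does not change this
    difference, because the nodes are contact points. *)
Lemma interpolation_bound (sg xb te d r : R) (bs : seq R) :
    sg * sg = 1 -> (forall i, 0 <= sg * (x i - xb)) -> 0 < d -> 0 <= r ->
    uniq bs -> ~~ odd (size bs) ->
    (forall t, t \in bs -> [/\ Theta lo hi t, 0 <= sg * (te - t) <= 2 * r,
       expsum t = rmgf p0 t & expsum' t = rmgf' p0 t]) ->
    Theta lo hi (te + sg * d) -> Theta lo hi (te + sg * (3 * d)) ->
  sg * ((rmgf' p0 (te + sg * d) - xb * rmgf p0 (te + sg * d))
      - (expsum' (te + sg * d) - xb * expsum (te + sg * d)))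
   * expR (- (te + sg * d) * xb)
  <= ((2 * r + d) / (2 * r + 2 * d)) ^+ size bs * (d^-1 * expR (- 1)) *
     (expR (- (te + sg * (3 * d)) * xb) * rmgf p0 (te + sg * (3 * d))).
Proof.
move=> sg2 hx d0 r0 ubs oddbs hbs hc hc3.
set c := te + sg * d; set rho := _ / _.
have rd0 : 0 < 2 * r + 2 * d by lra.
have rho0 : 0 <= rho by rewrite divr_ge0//; lra.
have sg0 : sg != 0 by apply/eqP => s0; move/eqP: sg2; rewrite s0 mul0r eq_sym oner_eq0.
have sgI : injective (fun t => sg * t) by exact: mulfI.
(* In the coordinate [Y] exponents are multiplied by [sg], so [c] becomes [sg * te + d]. With
   [u = sg * (te - t)] in [[0, 2 * r]], the ratio [(u + d) / (u + 2 * d)] increases in [u], hence is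
   at most [rho]. *)
have [||lam] := @exp_interpolation R (map (fun t => sg * t) bs) (sg * te + d) d rho d0.
- by rewrite map_inj_uniq.
- move=> _ /mapP[t tbs ->]; have [_ /andP[ht0 ht1] _ _] := hbs _ tbs.
  split; first by lra.
  rewrite /rho mulrAC ler_pdivlMr//.
  have : 0 <= d * (2 * r - sg * (te - t)) by rewrite mulr_ge0 ?(ltW d0)// subr_ge0.
  by lra.
rewrite /= size_map => -[Psip Psin].
pose Y (y : R) : R := sg * (y - xb).
pose h (t y : R) : R := Y y * expR (t * (y - xb)).
pose Psi (y : R) : R := expR ((sg * te + d) * y) -
  \sum_(t <- bs) lam (sg * t) * expR (sg * t * y).
have YE t y : expR (sg * t * Y y) = expR (t * (y - xb)).
  by rewrite /Y mulrACA sg2 mul1r.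
have YPsi y : Y y * Psi (Y y) = h c y - \sum_(t <- bs) lam (sg * t) * h t y.
  rewrite /Psi mulrBr mulr_sumr; congr (_ - _).
    rewrite /h -YE /c mulrDr [sg * (sg * _)]mulrA sg2 mul1r//.
  by apply: eq_bigr => t _; rewrite YE mulrCA.
have hE (t y : R) : h t y = sg * expR (- t * xb) * (y * expR (t * y) - xb * expR (t * y)).
  by rewrite /h /Y (_ : t * (y - xb) = - t * xb + t * y) ?expRD; ring.
have hF (t : R) : h t =
    fun y => sg * expR (- t * xb) * (y * expR (t * y) + - xb * expR (t * y)).
  by apply/funext => y; rewrite hE (mulNr xb).
have Ih (t : R) : Theta lo hi t -> pintegrable p0 (h t).
  move=> ht; rewrite hF.
  apply/pintegrableZ/pintegrableD; first exact: (pintegrable_mul_expR hp0 hmgf).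
  apply: pintegrableZ; exact: (pintegrable_expR hp0 hmgf).
have pinth t : Theta lo hi t ->
    pint p0 (h t) = sg * expR (- t * xb) * (rmgf' p0 t - xb * rmgf p0 t).
  move=> ht; rewrite hF.
  have ? := pintegrable_mul_expR hp0 hmgf ht.
  have ? := pintegrable_expR hp0 hmgf ht.
  have ? : pintegrable p0 (fun y => - xb * expR (t * y)) by exact: pintegrableZ.
  by rewrite pintZ ?pintD ?pintZ ?(mulNr xb)//; exact: pintegrableD.
have sumh t : \sum_(i < n) w i * h t (x i) =
    sg * expR (- t * xb) * (expsum' t - xb * expsum t).
  rewrite /expsum /expsum' mulr_sumr -sumrB mulr_sumr; apply: eq_bigr => i _.
  by rewrite hE; ring.
have Ibs : forall t, t \in bs -> pintegrable p0 (fun y => lam (sg * t) * h t y).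
  by move=> t /hbs[ht _ _ _]; exact/pintegrableZ/Ih.
have IPsi : pintegrable p0 (fun y => Y y * Psi (Y y)).
  under [X in pintegrable _ X]eq_fun do rewrite YPsi -mulN1r.
  by apply: pintegrableD; [exact: Ih|exact/pintegrableZ/pintegrable_sum].
have pintPsi : pint p0 (fun y => Y y * Psi (Y y)) =
    pint p0 (h c) - \sum_(t <- bs) lam (sg * t) * pint p0 (h t).
  under [X in pint _ X]eq_fun do rewrite YPsi -mulN1r.
  rewrite pintD ?pintZ ?pint_sum ?mulN1r//; last 3 first.
  - exact: pintegrable_sum.
  - exact: Ih.
  - exact/pintegrableZ/pintegrable_sum.
  congr (_ - _); rewrite !big_seq; apply: eq_bigr => t /hbs[ht _ _ _].
  by rewrite pintZ//; exact: Ih.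
have sumPsi : \sum_(i < n) w i * (Y (x i) * Psi (Y (x i))) =
    \sum_(i < n) w i * h c (x i) -
    \sum_(t <- bs) lam (sg * t) * \sum_(i < n) w i * h t (x i).
  under eq_bigr do rewrite YPsi mulrBr.
  rewrite sumrB; congr (_ - _); under [RHS]eq_bigr do rewrite mulr_sumr.
  rewrite exchange_big/=; apply: eq_bigr => i _; rewrite mulr_sumr.
  by apply: eq_bigr => t _; rewrite mulrCA.
(* Since [h t] carries the factor [Y], its integral involves both [rmgf t] and [rmgf' t]; value and
   derivative must therefore both agree at the nodes. *)
have eqbs : \sum_(t <- bs) lam (sg * t) * pint p0 (h t) =
    \sum_(t <- bs) lam (sg * t) * \sum_(i < n) w i * h t (x i).
  rewrite !big_seq; apply: eq_bigr => t /hbs[ht _ e e'].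
  by rewrite pinth// sumh e e'.
have sumPsi0 : 0 <= \sum_(i < n) w i * (Y (x i) * Psi (Y (x i))).
  apply: sumr_ge0 => i _; rewrite mulr_ge0// mulr_ge0//; first exact: hx.
  by have /andP[] := Psip _ (hx i); rewrite big_map.
apply: (@le_trans _ _ (pint p0 (fun y => Y y * Psi (Y y)))).
  rewrite sumPsi sumh in sumPsi0; rewrite pintPsi eqbs (pinth _ hc); lra.
(* Where [Y <= 0], the even number of nodes makes [Psi] nonnegative, so [Y * Psi <= 0 <= B]. Where
   [Y >= 0], the exponent [3 * d] adds up the evaluation point, the gap [p] of [exp_interpolation],
   and the absorption of the factor [Y] by [mul_expR_le]. *)
pose B (y : R) : R := rho ^+ size bs * (d^-1 * expR (- 1)) *
  expR (- (te + sg * (3 * d)) * xb) * expR ((te + sg * (3 * d)) * y).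
have YPsiB y : Y y * Psi (Y y) <= B y.
  have B0 : 0 <= B y by rewrite !mulr_ge0 ?exprn_ge0 ?expR_ge0// invr_ge0 ltW.
  have [Y0|/ltW Y0] := leP (Y y) 0.
    apply: le_trans B0; apply: mulr_le0_ge0 => //.
    have := Psin _ Y0; rewrite big_map -signr_odd (negbTE oddbs) expr0 mul1r; exact.
  have /andP[_] := Psip _ Y0; rewrite big_map => /(ler_wpM2l Y0) /le_trans; apply.
  rewrite (_ : B y = rho ^+ size bs *
    (d^-1 * expR (- 1) * expR (d * Y y) * expR ((sg * te + d + d) * Y y))).
    by rewrite mulrCA ler_wpM2l ?exprn_ge0// ler_wpM2r ?expR_ge0// mul_expR_le.
  rewrite /B -!mulrA; congr (_ * (_ * (_ * _))); rewrite -!expRD; congr expR.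
  rewrite -mulrDl; transitivity (sg * (te + sg * (3 * d)) * Y y).
    by rewrite /Y mulrACA sg2; ring.
  by congr (_ * _); rewrite mulrDr mulrA sg2; ring.
have IB : pintegrable p0 B by apply: pintegrableZ; exact: (pintegrable_expR hp0 hmgf).
apply: le_trans (le_pint hp0 IPsi IB YPsiB) _.
rewrite /B pintZ; last exact: (pintegrable_expR hp0 hmgf).
by rewrite -!mulrA.
Qed.

End interpolation_bound.

(** * First-order optimality of the NPMLE *)

(** Apply [ln z <= z - 1] to [z = (1 + v)^-1]: this gives [ln (1 + v) >= z * v = v - z * v ^+ 2],
    and [z <= 2]. *)
Lemma ln1D_ge (R : realType) (v : R) : - (1 / 2) <= v -> v - 2 * v ^+ 2 <= ln (1 + v).
Proof.
move=> v12; have v0 : 0 < 1 + v by lra.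
set z := (1 + v)^-1.
have z0 : 0 < z by rewrite invr_gt0.
have zv : z + z * v = 1 by rewrite -[z in z + _]mulr1 -mulrDr mulVf// gt_eqF.
have z2 : z <= 2 by rewrite -(invrK 2) lef_pV2 ?posrE//; lra.
have : ln z <= z - 1 by rewrite -{1}(subrK 1 z) addrC le_ln1Dx//; lra.
rewrite lnV ?posrE// => lnz.
have : 0 <= v ^+ 2 * (2 - z) by rewrite mulr_ge0 ?sqr_ge0// subr_ge0.
have -> : v ^+ 2 * (2 - z) = 2 * v ^+ 2 - v * (z * v) by ring.
have -> : z * v = 1 - z by lra.
by lra.
Qed.

(** The sum of the [u i] is the right derivative at [e = 0] of a function that vanishes there and is
    nonpositive afterwards; the proof replaces the limit by one explicit [e]. *)
Lemma sum_ln1D_le0 (R : realType) (n : nat) (u : 'I_n -> R) :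
    (forall i, -1 < u i) ->
    (forall e, 0 < e < 1 -> \sum_(i < n) ln (1 + e * u i) <= 0) ->
  \sum_(i < n) u i <= 0.
Proof.
move=> u1 hu; rewrite leNgt; apply/negP; set s := \sum_(i < n) u i => s0.
pose K := \sum_(i < n) u i ^+ 2.
have K0 : 0 <= K by apply: sumr_ge0 => i _; exact: sqr_ge0.
have sK0 : 0 < 2 * s + 2 * K by lra.
(* This choice gives [e <= 1 / 2], so that [ln1D_ge] applies to every [e * u i], and also
   [2 * e * K < s], so that the quadratic loss stays below the linear gain. *)
pose e := s / (2 * s + 2 * K).
have e0 : 0 < e by rewrite divr_gt0.
have e12 : e <= 1 / 2 by rewrite ler_pdivrMr//; lra.
have eK : e * (2 * K) < s.
  by rewrite /e mulrAC ltr_pdivrMr// ltr_pM2l//; lra.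
have : e * s - 2 * e ^+ 2 * K <= 0.
  apply: le_trans (hu e _); last by rewrite e0/=; lra.
  rewrite /s /K !mulr_sumr -sumrB; apply: ler_sum => i _.
  have : - (1 / 2) <= e * u i.
    by have := ler_wpM2l (ltW e0) (ltW (u1 i)); lra.
  move=> /ln1D_ge; apply: le_trans.
  by have -> : 2 * (e * u i) ^+ 2 = 2 * e ^+ 2 * u i ^+ 2 by ring.
have -> : e * s - 2 * e ^+ 2 * K = e * (s - e * (2 * K)) by ring.
by rewrite pmulr_rle0// subr_le0 leNgt eK.
Qed.

(** * Convex combinations of probability measures *)

Section probability_conv.
Context d (T : measurableType d) (R : realType).
Variables (k : R) (k0 : 0 <= k) (k1 : 0 <= 1 - k) (P Q : probability T R).

Definition probability_conv : set T -> \bar R :=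
  measure_add (mscale (NngNum k1) P) (mscale (NngNum k0) Q).

HB.instance Definition _ := Measure.on probability_conv.

Let probability_convT : probability_conv setT = 1%E.
Proof.
by rewrite /probability_conv measure_addE/= /mscale/= !probability_setT !mule1 -EFinD subrK.
Qed.

HB.instance Definition _ :=
  Measure_isProbability.Build _ _ _ probability_conv probability_convT.

Lemma probability_convE (A : set T) :
  probability_conv A = ((1 - k)%:E * P A + k%:E * Q A)%E.
Proof. by rewrite /probability_conv measure_addE. Qed.

Lemma integral_probability_conv (D : set T) (f : T -> \bar R) :
    measurable D -> (forall x, D x -> (0 <= f x)%E) -> measurable_fun D f ->
  (\int[probability_conv]_(x in D) f x =
   (1 - k)%:E * \int[P]_(x in D) f x + k%:E * \int[Q]_(x in D) f x)%E.
Proof.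
move=> mD f0 mf; rewrite ge0_integral_measure_add//.
by rewrite !ge0_integral_mscale.
Qed.

End probability_conv.

(** * Likelihoods and the gradient inequality for the NPMLE *)

Section npmle.
Context (R : realType) (p0 : R -> R) (hp0 : is_density p0) (lo hi : \bar R).
Hypothesis hmgf : forall t : R, Theta lo hi t -> (mgf p0 t < +oo)%E.

Let p0_ge0 x : 0 <= p0 x. Proof. by case: hp0. Qed.

Lemma expfam_ge0 t x : 0 <= expfam p0 t x.
Proof. by rewrite mulr_ge0 ?expR_ge0. Qed.

Lemma expfamE t x : Theta lo hi t ->
  expfam p0 t x = p0 x * expR (t * x) / rmgf p0 t.
Proof.
move=> ht; rewrite /expfam cgfE expRD expRN lnK ?posrE ?(rmgf_gt0 hp0 hmgf)//.
by rewrite mulrAC [_ * p0 x]mulrC.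
Qed.

Lemma measurable_Theta : measurable (Theta lo hi : set (measurableTypeR R)).
Proof. by apply: open_measurable; exact: open_set_Theta. Qed.

Lemma measurable_expfam x :
  measurable_fun (Theta lo hi : set (measurableTypeR R))
    (fun t => (expfam p0 t x)%:E).
Proof.
apply/measurable_EFinP; apply: open_continuous_measurable_fun.
  exact: open_set_Theta.
move=> t /set_mem ht; have d := is_derive_cgf hp0 hmgf ht.
apply/differentiable_continuous/derivable1_diffP.
have -> : (fun t => expfam p0 t x) = (fun t => p0 x * expR (x * t - cgf p0 t)).
  by apply/funext => s; rewrite /expfam mulrC (mulrC s).
have d2 : is_derive t 1 (fun t => x * t - cgf p0 t) (x - rmgf' p0 t / rmgf p0 t).
  by apply: is_derive_eq; rewrite /GRing.scale/= mulr1.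
have := @is_derive1_comp _ (@expR R) (fun t => x * t - cgf p0 t) t _ _ _ d2.
by move=> /(_ _ (is_derive_expR _)) d3; exact: ex_derive.
Qed.

(** A bound uniform in [t]. For [t >= 0], replace [x] by the larger [mean_map p0 tmax] and use the
    tangent line of [cgf p0] at [tmax]; for [t <= 0], do the same at [tmin]. The sum stands in for
    the maximum of the two bounds. *)
Lemma expfam_le tmin tmax x t : Theta lo hi tmin -> Theta lo hi tmax ->
    mean_map p0 tmin <= x <= mean_map p0 tmax -> Theta lo hi t ->
  expfam p0 t x <= (expR (mean_map p0 tmin * tmin - cgf p0 tmin)
                  + expR (mean_map p0 tmax * tmax - cgf p0 tmax)) * p0 x.
Proof.
move=> htmin htmax /andP[xmin xmax] ht; rewrite ler_wpM2r//.
have := cgf_tangent_le hp0 hmgf htmin ht.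
have := cgf_tangent_le hp0 hmgf htmax ht.
move: (mean_map p0 tmin) (mean_map p0 tmax) xmin xmax.
move: (cgf p0 tmin) (cgf p0 tmax) (cgf p0 t).
move=> k1 k2 k m1 m2 xmin xmax h2 h1.
have e1 := expR_ge0 (m1 * tmin - k1); have e2 := expR_ge0 (m2 * tmax - k2).
have [t0|/ltW t0] := leP 0 t.
  suff : expR (t * x - k) <= expR (m2 * tmax - k2) by lra.
  by rewrite ler_expR; have := ler_wpM2l t0 xmax; lra.
suff : expR (t * x - k) <= expR (m1 * tmin - k1) by lra.
by rewrite ler_expR; have := ler_wnM2l t0 xmin; lra.
Qed.

Context (tmin tmax : R) (htmin : Theta lo hi tmin) (htmax : Theta lo hi tmax).

(** This allows passing from extended real log-likelihoods to real ones. A zero integral of the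
    positive function [expfam] would make [Theta lo hi] null; finiteness comes from the uniform
    bound [expfam_le]. *)
Lemma mixture_fin_gt0 (pi : probability (measurableTypeR R) R) x :
    mixing lo hi pi -> 0 < p0 x -> mean_map p0 tmin <= x <= mean_map p0 tmax ->
  (0 < mixture p0 lo hi pi x < +oo)%E.
Proof.
move=> piT px xm; have mf := measurable_expfam x; have mT := measurable_Theta.
apply/andP; split.
  rewrite lt_neqAle integral_ge0 ?andbT; last by move=> t _; rewrite lee_fin expfam_ge0.
  apply/eqP => /esym h.
  have : (\int[pi]_(t in Theta lo hi) `|(expfam p0 t x)%:E| = 0)%E.
    rewrite -h; apply: eq_integral => t _; rewrite /= ger0_norm//; exact: expfam_ge0.
  move=> /(ae_eq_integral_abs pi mT mf) h0.
  have : pi.-negligible (Theta lo hi).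
    apply: negligibleS h0 => t ht /= /(_ ht)/eqP.
    by rewrite eqe /expfam mulf_eq0 gt_eqF ?expR_gt0//= gt_eqF.
  move=> /(negligibleP pi mT) pi0; have /eqP := etrans (esym piT) pi0.
  by rewrite onee_eq0.
pose C := (expR (mean_map p0 tmin * tmin - cgf p0 tmin)
                  + expR (mean_map p0 tmax * tmax - cgf p0 tmax)) * p0 x.
apply: (@le_lt_trans _ _ (\int[pi]_(t in Theta lo hi) (cst C%:E) t)%E).
  apply: ge0_le_integral => //.
  - by move=> t _; rewrite lee_fin expfam_ge0.
  - by move=> t ht; rewrite lee_fin; exact: expfam_le.
by rewrite integral_cst// [X in (_ * X)%E]piT mule1 ltry.
Qed.

Context (n : nat) (hn : (0 < n)%N) (x : 'I_n -> R) (hx : forall i, 0 < p0 (x i))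
  (xm : forall i, mean_map p0 tmin <= x i <= mean_map p0 tmax)
  (pi : probability (measurableTypeR R) R) (hpi : is_npmle p0 lo hi x pi).

Let f i : R := fine (mixture p0 lo hi pi (x i)).

Let mixtureE i : mixture p0 lo hi pi (x i) = (f i)%:E.
Proof.
have [piT _] := hpi; have /andP[h1 h2] := mixture_fin_gt0 piT (hx i) (xm i).
by rewrite fineK// gt0_fin_numE.
Qed.

Let f_gt0 i : 0 < f i.
Proof.
have [piT _] := hpi; have /andP[h1 h2] := mixture_fin_gt0 piT (hx i) (xm i).
by rewrite -lte_fin -mixtureE.
Qed.

Let avg_loglikE (pi' : probability (measurableTypeR R) R) (g : 'I_n -> R) :
  (forall i, mixture p0 lo hi pi' (x i) = (g i)%:E) -> (forall i, 0 < g i) ->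
  avg_loglik p0 lo hi x pi' = (n%:R^-1 * \sum_(i < n) ln (g i))%:E.
Proof.
move=> hg g0; rewrite /avg_loglik EFinM; congr (_ * _)%E.
by rewrite -sumEFin; apply: eq_bigr => i _; rewrite hg lne_EFin.
Qed.

(** Moving a mass [e] from [pi] to the Dirac measure at [t] changes the log-likelihood sum by the
    sum of [ln (1 + e * (g i / f i - 1))]. This is nonpositive for every [e] by maximality, so
    [sum_ln1D_le0] applies. *)
Lemma npmle_gradient_le t : Theta lo hi t ->
  \sum_(i < n) expfam p0 t (x i) / f i <= n%:R.
Proof.
move=> ht; have [piT hmax] := hpi.
pose g i := expfam p0 t (x i).
have g0 i : 0 < g i by rewrite mulr_gt0 ?expR_gt0.
suff : \sum_(i < n) (g i / f i - 1) <= 0.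
  by rewrite sumrB sumr_const card_ord subr_le0.
apply: sum_ln1D_le0 => [i|e /andP[e0 e1]].
  by rewrite ltrBrDr addNr divr_gt0.
have e10 : 0 <= 1 - e by rewrite subr_ge0 ltW.
pose pi' := probability_conv (ltW e0) e10 pi (\d_ (t : measurableTypeR R)).
have pi'T : mixing lo hi pi'.
  apply: (etrans (probability_convE (ltW e0) e10 pi _ (Theta lo hi))).
  transitivity ((1 - e)%:E * 1 + e%:E * 1)%E; last by rewrite !mule1 -EFinD subrK.
  have dT : (\d_ (t : measurableTypeR R) (Theta lo hi) = 1 :> \bar R)%E.
    by rewrite diracE mem_set.
  by congr (_ * _ + _ * _)%E; [exact: piT|exact: dT].
have mix' i : mixture p0 lo hi pi' (x i) = ((1 - e) * f i + e * g i)%:E.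
  rewrite /mixture integral_probability_conv//; last 3 first.
  - exact: measurable_Theta.
  - by move=> s _; rewrite lee_fin expfam_ge0.
  - exact: measurable_expfam.
  rewrite -/(mixture p0 lo hi pi (x i)) mixtureE integral_dirac//; last 2 first.
  - exact: measurable_Theta.
  - exact: measurable_expfam.
  by rewrite diracE mem_set//= mul1e -!EFinM -EFinD.
have mix'0 i : 0 < (1 - e) * f i + e * g i.
  have a0 := mulr_ge0 e10 (ltW (f_gt0 i)); have b0 := mulr_gt0 e0 (g0 i).
  by lra.
have := hmax pi' pi'T.
rewrite (avg_loglikE mix' mix'0) (avg_loglikE mixtureE f_gt0) lee_fin.
rewrite ler_pM2l ?invr_gt0 ?ltr0n// -subr_le0 -sumrB; apply: le_trans.
rewrite le_eqVlt; apply/orP; left; apply/eqP; apply: eq_bigr => i _.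
rewrite -ln_div ?posrE//; congr ln.
by rewrite mulrDl mulfK ?gt_eqF//; ring.
Qed.

(** Each ratio [expfam p0 t (x i) / f i] has [pi]-integral 1, so [D] integrates to [n]. As [D <= n]
    on [Theta lo hi], the nonnegative function [n - D] has integral 0 and vanishes almost
    everywhere. *)
Lemma npmle_gradient_ae :
  pi.-negligible (Theta lo hi `&`
    [set t | \sum_(i < n) expfam p0 t (x i) / f i < n%:R]).
Proof.
have [piT _] := hpi; have mT := measurable_Theta.
pose D t := \sum_(i < n) expfam p0 t (x i) / f i.
have mD : measurable_fun (Theta lo hi : set (measurableTypeR R)) D.
  apply: measurable_sum => i; apply: measurable_funM => //.
  by apply/measurable_EFinP; exact: measurable_expfam.
have intD : (\int[pi]_(t in Theta lo hi) (D t)%:E = n%:R%:E)%E.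
  under eq_integral do rewrite /D -sumEFin.
  rewrite ge0_integral_sum//; last 2 first.
  - move=> i; apply/measurable_EFinP; apply: measurable_funM => //.
    by apply/measurable_EFinP; exact: measurable_expfam.
  - by move=> i t _; rewrite lee_fin divr_ge0 ?expfam_ge0 ?ltW.
  transitivity (\sum_(i < n) (1 : R)%:E)%E; last by rewrite sumEFin sumr_const card_ord.
  apply: eq_bigr => i _; under eq_integral do rewrite mulrC EFinM.
  rewrite ge0_integralZl_EFin//; last 3 first.
  - by move=> t _; rewrite lee_fin expfam_ge0.
  - exact: measurable_expfam.
  - by rewrite invr_ge0 ltW.
  rewrite -/(mixture p0 lo hi pi (x i)) mixtureE -EFinM mulVf// gt_eqF//.
have D0 t : 0 <= D t by apply: sumr_ge0 => i _; rewrite divr_ge0 ?expfam_ge0 ?ltW.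
have Dn t : Theta lo hi t -> 0 <= n%:R - D t.
  by move=> ht; rewrite subr_ge0 npmle_gradient_le.
have mnD : measurable_fun (Theta lo hi : set (measurableTypeR R))
    (fun t => (n%:R - D t)%:E).
  by apply/measurable_EFinP; exact: measurable_funB.
have : (\int[pi]_(t in Theta lo hi) `|(n%:R - D t)%:E| = 0)%E.
  transitivity (\int[pi]_(t in Theta lo hi) (n%:R - D t)%:E)%E.
    by apply: eq_integral => t /set_mem ht; rewrite /= ger0_norm// Dn.
  (* Additivity is used only for nonnegative functions; the finite value [n] is then cancelled from
     both sides. *)
  have : (\int[pi]_(t in Theta lo hi) ((D t)%:E + (n%:R - D t)%:E) = n%:R%:E)%E.
    under eq_integral do rewrite -EFinD subrKC.
    by rewrite integral_cst// [X in (_ * X)%E]piT mule1.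
  have f10 t : Theta lo hi t -> (0 <= (D t)%:E)%E by rewrite lee_fin.
  have f20 t : Theta lo hi t -> (0 <= (n%:R - D t)%:E)%E by rewrite lee_fin; exact: Dn.
  have mD' : measurable_fun (Theta lo hi : set (measurableTypeR R))
      (fun t => (D t)%:E).
    exact/measurable_EFinP.
  rewrite (ge0_integralD pi mT f10 mD' f20 mnD).
  rewrite intD => /(congr1 (fun z => z - n%:R%:E)%E).
  by rewrite addeC addeK// subee.
move=> /(ae_eq_integral_abs pi mT mnD); apply: negligibleS.
by move=> t [ht /= Dt] /(_ ht)/eqP; rewrite eqe subr_eq0 gt_eqF.
Qed.

Lemma npmle_optimality : exists w : 'I_n -> R,
  [/\ forall i, 0 < w i,
      forall t, Theta lo hi t -> expsum x w t <= rmgf p0 t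
    & pi.-negligible (Theta lo hi `&` [set t | expsum x w t < rmgf p0 t])].
Proof.
(* With these weights the gradient sum equals [n * expsum t / rmgf t], because [p0 (x i)] factors
   out of [expfam] and [rmgf] is its normalising constant. *)
pose w i := p0 (x i) / (n%:R * f i).
have n0 : 0 < n%:R :> R by rewrite ltr0n.
have wE t : Theta lo hi t ->
    \sum_(i < n) expfam p0 t (x i) / f i = n%:R * (expsum x w t / rmgf p0 t).
  move=> ht; rewrite /expsum mulr_suml mulr_sumr; apply: eq_bigr => i _.
  rewrite expfamE// /w invfM; field.
  by rewrite (gt_eqF (f_gt0 i)) (gt_eqF n0) gt_eqF// (rmgf_gt0 hp0 hmgf).
exists w; split.
- by move=> i; rewrite divr_gt0// mulr_gt0.
- move=> t ht; have := npmle_gradient_le ht.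
  by rewrite wE// -ler_pdivlMl// mulVf ?gt_eqF// ler_pdivrMr ?(rmgf_gt0 hp0 hmgf)// mul1r.
- apply: negligibleS npmle_gradient_ae => t [ht /= h]; split => //=.
  rewrite wE// -ltr_pdivlMl// mulVf ?gt_eqF//.
  by rewrite ltr_pdivrMr ?(rmgf_gt0 hp0 hmgf)// mul1r.
Qed.

End npmle.

(** * Contact points and the support of the NPMLE *)

Lemma Theta_convex (R : realType) (lo hi : \bar R) (a b t : R) :
  Theta lo hi a -> Theta lo hi b -> a <= t <= b -> Theta lo hi t.
Proof.
move=> /andP[loa _] /andP[_ bhi] /andP[at_ tb]; apply/andP; split.
  by rewrite (lt_le_trans loa)// lee_fin.
by rewrite (le_lt_trans _ bhi)// lee_fin.
Qed.

Section support.
Context (R : realType) (p0 : R -> R) (hp0 : is_density p0) (lo hi : \bar R).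
Hypothesis hmgf : forall t : R, Theta lo hi t -> (mgf p0 t < +oo)%E.
Context (n : nat) (hn : (0 < n)%N) (x w : 'I_n -> R) (w0 : forall i, 0 < w i).
Hypothesis expsum_le : forall t, Theta lo hi t -> expsum x w t <= rmgf p0 t.

Lemma expsum_gt0 (t : R) : 0 < expsum x w t.
Proof.
rewrite /expsum; case: n hn x w w0 => // m _ y v v0.
rewrite big_ord_recl ltr_pwDl// ?mulr_gt0 ?expR_gt0//.
by apply: sumr_ge0 => i _; rewrite mulr_ge0 ?expR_ge0// ltW.
Qed.

Lemma le_expsum' (b t : R) : (forall i, x i <= b) ->
  expsum' x w t <= b * expsum x w t.
Proof.
move=> xb; rewrite /expsum /expsum' mulr_sumr; apply: ler_sum => i _.
by rewrite [leRHS]mulrCA ler_pM2l// ler_pM2r ?expR_gt0.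
Qed.

Lemma ge_expsum' (b t : R) : (forall i, b <= x i) ->
  b * expsum x w t <= expsum' x w t.
Proof.
move=> xb; rewrite /expsum /expsum' mulr_sumr; apply: ler_sum => i _.
by rewrite [leLHS]mulrCA ler_pM2l// ler_pM2r ?expR_gt0.
Qed.

Lemma is_derive_expsum (t : R) : is_derive t 1 (expsum x w) (expsum' x w t).
Proof.
rewrite /expsum /expsum'; under eq_fun do under eq_bigr do rewrite mulrC.
under eq_fun do under eq_bigr do rewrite mulrC (mulrC _ (x _)).
by under eq_bigr do rewrite (mulrC t); exact: is_derive_exp_sum.
Qed.

(** At a contact point [expsum - rmgf] attains its maximum 0 in the interior of [Theta lo hi], so
    its derivative vanishes. *)
Lemma expsum'_eq (t : R) : Theta lo hi t -> expsum x w t = rmgf p0 t ->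
  expsum' x w t = rmgf' p0 t.
Proof.
move=> /open_Theta[e e0 he] et.
pose f s := expsum x w s - rmgf p0 s.
have df s : Theta lo hi s -> is_derive s 1 f (expsum' x w s - rmgf' p0 s).
  move=> hs; have d1 := is_derive_expsum s; have d2 := is_derive_rmgf hp0 hmgf hs.
  exact: is_deriveB.
have hI s : s \in `]t - e, t + e[ -> Theta lo hi s.
  by rewrite in_itv/= => /andP[? ?]; apply: he; rewrite ler_norml; apply/andP; split; lra.
have tI : t \in `]t - e, t + e[ by rewrite in_itv/=; apply/andP; split; lra.
have := @derive1_at_max _ f (t - e) (t + e) t _ _ tI _.
case.
- by lra.
- by move=> s /hI/df ?; exact: ex_derive.
- move=> s /hI hs; rewrite /f et subrr subr_le0; exact: expsum_le.
move=> _; have [_ ->] := df _ (hI _ tI).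
by move=> /eqP; rewrite subr_eq0 => /eqP.
Qed.

Context (tmin tmax : R) (htmin : Theta lo hi tmin) (htmax : Theta lo hi tmax)
  (xm : forall i, mean_map p0 tmin <= x i <= mean_map p0 tmax).

(** At contact, [mean_map p0 t] equals [expsum' / expsum], a weighted average of the data points. It
    lies between the means at [tmin] and [tmax], and [mean_map] is strictly increasing. *)
Lemma contact_itv (t : R) : Theta lo hi t -> expsum x w t = rmgf p0 t ->
  tmin <= t <= tmax.
Proof.
move=> ht et; have et' := expsum'_eq ht et.
have /andP[m1 m2] : mean_map p0 tmin <= mean_map p0 t <= mean_map p0 tmax.
  rewrite (mean_mapE hp0 hmgf ht) -et -et' ler_pdivrMr ?ler_pdivlMr ?expsum_gt0//.
  by rewrite ge_expsum' ?le_expsum'// => i; have /andP[] := xm i.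
apply/andP; split; rewrite leNgt; apply/negP => h.
  by have := lt_le_trans (mean_map_lt hp0 hmgf ht htmin h) m1; rewrite ltxx.
by have := le_lt_trans m2 (mean_map_lt hp0 hmgf htmax ht h); rewrite ltxx.
Qed.

Lemma supp_contact (pi : probability (measurableTypeR R) R) : mixing lo hi pi ->
    pi.-negligible (Theta lo hi `&` [set t | expsum x w t < rmgf p0 t]) ->
  forall t, supp pi t -> tmin <= t <= tmax /\ expsum x w t = rmgf p0 t.
Proof.
move=> piT neg t st.
(* Both claims are proved by contradiction, by exhibiting a negligible open neighbourhood of [t]:
   the complement of [[tmin, tmax]] for the first, a ball on which [rmgf - expsum] stays positive
   for the second. *)
have null V : open V -> V t -> ~ pi.-negligible V.
  move=> oV Vt /negligibleP h; have := st V oV Vt.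
  by rewrite h ?ltxx//; exact: open_measurable.
have lt_of s : Theta lo hi s -> expsum x w s != rmgf p0 s -> expsum x w s < rmgf p0 s.
  by move=> hs; rewrite lt_neqAle => ->/=; exact: expsum_le.
have negC : pi.-negligible (~` Theta lo hi).
  have mT := measurable_Theta lo hi.
  have C0 : pi (~` Theta lo hi) = 0%E.
    by rewrite probability_setC// [X in (_ - X)%E]piT subee.
  by apply/negligibleP; [exact: measurableC|exact: C0].
have tI : tmin <= t <= tmax.
  apply: contrapT => tN; apply: (null (~` [set` `[tmin, tmax]])).
  - by rewrite openC; exact: interval_closed.
  - by rewrite /= in_itv.
  apply: negligibleS (negligibleU negC neg) => s /=; rewrite in_itv/= => sN.
  have [hs|] := pselect (Theta lo hi s); [right; split => //=|by left].
  by apply: lt_of => //; apply/eqP => /(contact_itv hs).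
split => //; have ht := Theta_convex htmin htmax tI.
apply: contrapT => /eqP /(lt_of _ ht); rewrite -subr_gt0.
pose h s := rmgf p0 s - expsum x w s; rewrite -/(h t) => ht0.
have ch : {for t, continuous h}.
  apply/differentiable_continuous/derivable1_diffP.
  have d1 := is_derive_expsum t; have d2 := is_derive_rmgf hp0 hmgf ht.
  by have d3 := is_deriveB d2 d1; exact: ex_derive.
have nh : nbhs t [set s | 0 < h s] by exact: (cvgr_gt (h t) ch).
have nT : nbhs t (Theta lo hi).
  by apply: open_nbhs_nbhs; split => //; exact: open_set_Theta.
have [e /= e0 he] := (nbhs_ballP _ _).1 (filterI nT nh); apply: (null (ball t e)).
- exact: ball_open.
- exact: ballxx.
- apply: negligibleS neg => s /he[hs /=]; rewrite /h subr_gt0 => ?; by split.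
Qed.

End support.

(** * The bound on the number of atoms *)

Lemma ln_le_of_prod (R : realType) (N : nat) (tau d rho L L3 u v : R) :
    0 < tau -> 0 < d -> 0 < rho -> 0 < L -> 0 < L3 ->
    tau * L * expR u <= rho ^+ N * (d^-1 * expR (- 1)) * (expR v * L3) ->
  N%:R * - ln rho <= ln L3 - ln L + v - u - 1 - ln (d * tau).
Proof.
move=> t0 d0 r0 L0 L30 h.
have rN0 : 0 < rho ^+ N by rewrite exprn_gt0.
have d10 : 0 < d^-1 by rewrite invr_gt0.
move: h; rewrite -ler_ln ?posrE ?mulr_gt0 ?expR_gt0// !lnM ?posrE ?mulr_gt0 ?expR_gt0//.
rewrite !expRK lnXn// lnV ?posrE// mulr_natl; lra.
Qed.

Section one_sided_bound.
Context (R : realType) (p0 : R -> R) (hp0 : is_density p0) (lo hi : \bar R).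
Hypothesis hmgf : forall t : R, Theta lo hi t -> (mgf p0 t < +oo)%E.
Context (n : nat) (x w : 'I_n -> R) (w0 : forall i, 0 <= w i).
Hypothesis expsum_le : forall t, Theta lo hi t -> expsum x w t <= rmgf p0 t.
Hypothesis contact : forall t, Theta lo hi t -> expsum x w t = rmgf p0 t ->
  expsum' x w t = rmgf' p0 t.

(* sg = 1 works from the right end: te = tmax, xe = xmax, xb = xmin; sg = -1 is
   the mirror image. *)
Variables (sg xb xe te d r : R).
Hypotheses (sg2 : sg * sg = 1) (hxb : forall i, 0 <= sg * (x i - xb))
  (hxe : forall i, sg * (x i - xe) <= 0) (hxbe : 0 <= sg * (xe - xb))
  (d0 : 0 < d) (r0 : 0 <= r).
Let c := te + sg * d.
Let c3 := te + sg * (3 * d).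
Let tau := sg * (mean_map p0 c - xe).
Hypotheses (hc : Theta lo hi c) (hc3 : Theta lo hi c3) (tau0 : 0 < tau).

Definition contact_point t :=
  [/\ Theta lo hi t, 0 <= sg * (te - t) <= 2 * r & expsum x w t = rmgf p0 t].

(** Logarithms are taken in [interpolation_bound], once its left side is bounded below by
    [tau * rmgf c] times the exponential factor. For this, the data sum is at most
    [sg * (xe - xb) * expsum c], and [expsum c <= rmgf c] turns [xb] into [xe]. *)
Let even_bound (bs : seq R) : uniq bs -> ~~ odd (size bs) ->
    (forall t, t \in bs -> contact_point t) ->
  (size bs)%:R * ln ((2 * r + 2 * d) / (2 * r + d)) <=
    cgf p0 c3 - cgf p0 c - 2 * (sg * d * xb) - 1 - ln (d * tau).
Proof.
move=> ubs obs hbs.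
have hbs' t : t \in bs -> [/\ Theta lo hi t, 0 <= sg * (te - t) <= 2 * r,
    expsum x w t = rmgf p0 t & expsum' x w t = rmgf' p0 t].
  by move=> /hbs[h1 h2 h3]; split => //; exact: contact.
have := interpolation_bound hp0 hmgf w0 sg2 hxb d0 r0 ubs obs hbs' hc hc3.
have Lc := rmgf_gt0 hp0 hmgf hc; have Lc3 := rmgf_gt0 hp0 hmgf hc3.
have mE : rmgf' p0 c = mean_map p0 c * rmgf p0 c.
  by rewrite (mean_mapE hp0 hmgf hc) divfK// gt_eqF.
have SL := expsum_le hc.
have SE : sg * (expsum' x w c - xb * expsum x w c) <= sg * (xe - xb) * expsum x w c.
  rewrite /expsum /expsum' !mulr_sumr -sumrB mulr_sumr; apply: ler_sum => i _.
  have := mulr_ge0 (w0 i) (expR_ge0 (c * x i)).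
  have := hxe i; rewrite -oppr_ge0 => h1 h2; have := mulr_ge0 h1 h2; lra.
rewrite !cgfE; move: tau0 SE SL mE Lc Lc3; rewrite /tau -/c -/c3.
move: (rmgf' p0 c) (rmgf p0 c) (rmgf p0 c3) (mean_map p0 c) (expsum x w c) (expsum' x w c).
move=> L' L L3 m S S' m0 SE SL -> L0 L30 h.
have rd : 0 < 2 * r + d by rewrite ltr_wpDl// mulr_ge0.
have rd2 : 0 < 2 * r + 2 * d by rewrite ltr_wpDl ?mulr_ge0 ?mulr_gt0.
have := @ln_le_of_prod R (size bs) (sg * (m - xe)) d ((2 * r + d) / (2 * r + 2 * d)) L L3
  (- c * xb) (- c3 * xb) m0 d0 (divr_gt0 rd rd2) L0 L30.
rewrite -lnV ?posrE ?divr_gt0// invf_div => H.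
apply: le_trans (H _) _; last first.
  have -> : - c3 * xb = - c * xb - 2 * (sg * d * xb) by rewrite /c /c3; ring.
  by lra.
apply: le_trans h; rewrite ler_wpM2r ?expR_ge0//.
have := ler_wpM2l hxbe SL; lra.
Qed.

Lemma one_sided_bound (bs : seq R) : uniq bs ->
    (forall t, t \in bs -> contact_point t) ->
  (size bs)%:R * ln ((2 * r + 2 * d) / (2 * r + d)) <=
    cgf p0 c3 - cgf p0 c - 2 * (sg * d * xb) - ln (d * tau).
Proof.
(* The term [- 1] of [even_bound] absorbs one more node, as [ln _ <= ln 2 <= 1]. *)
move=> ubs hbs.
have rd : 0 < 2 * r + d by rewrite ltr_wpDl// mulr_ge0.
have l1 : ln ((2 * r + 2 * d) / (2 * r + d)) <= 1.
  have -> : (2 * r + 2 * d) / (2 * r + d) = 1 + d / (2 * r + d).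
    by field; rewrite gt_eqF.
  have dr : d / (2 * r + d) <= 1 by rewrite ler_pdivrMr// mul1r ler_wpDl// mulr_ge0.
  apply: le_trans dr; apply: le_ln1Dx.
  by rewrite (lt_le_trans _ (divr_ge0 (ltW d0) (ltW rd)))// ltrN10.
have [obs|ebs] := boolP (odd (size bs)); last by have := even_bound ubs ebs hbs; lra.
case: bs ubs hbs obs => // b bs /= /andP[_ ubs] hbs obs.
have := even_bound ubs obs (fun t tbs => hbs t (mem_behead (s := b :: bs) tbs)).
rewrite -[(size bs).+1%:R]natr1 (mulrDl (size bs)%:R 1) mul1r; lra.
Qed.

End one_sided_bound.

(** Reduces the one-sided estimate to the symmetric constant [N1]: [- Kc] is controlled by the
    tangent of the cumulant function at 0, the shift term by the bound on [|xb|], and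
    [- ln (d * tau)] is [ln ((1 / d) / tau)], to which [X] may be added. *)
Lemma budget_ge (R : realType) (K3 kmax Kc m0 te d sg xb tau a x0 T X : R) :
    K3 <= kmax -> m0 * (te + sg * d) <= Kc -> `|sg| = 1 -> `|te| <= T ->
    `|xb| <= a + `|x0| -> 0 < d -> 0 < tau -> 0 <= X ->
  K3 - Kc - 2 * (sg * d * xb) - ln (d * tau) <=
  2 * (a + `|m0| + `|x0|) * (T + 2 * d) + kmax + ln ((X + 1 / d) / tau).
Proof.
move=> K3k Kcm sg1 teT xba d0 tau0 X0.
have T0 : 0 <= T by rewrite (le_trans _ teT).
have l1 : - ln (d * tau) <= ln ((X + 1 / d) / tau).
  rewrite -lnV ?posrE ?mulr_gt0// invfM ler_ln ?posrE; last 2 first.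
  - by rewrite mulr_gt0 ?invr_gt0.
  - by rewrite divr_gt0// ltr_wpDl// divr_gt0.
  by rewrite ler_wpM2r ?invr_ge0 ?(ltW tau0)// mul1r lerDr.
have l2 : - (m0 * (te + sg * d)) <= `|m0| * (T + d).
  rewrite -mulrN (le_trans (ler_norm _))// normrM normrN ler_wpM2l//.
  rewrite (le_trans (ler_normD _ _))// lerD// normrM sg1 mul1r gtr0_norm//.
have l3 : - (sg * d * xb) <= d * (a + `|x0|).
  rewrite -mulrN (le_trans (ler_norm _))// normrM normrN normrM sg1 mul1r gtr0_norm//.
  by rewrite ler_wpM2l// ltW.
have A0 : 0 <= a + `|x0| by rewrite (le_trans _ xba).
have h1 := mulr_ge0 A0 T0; have h2 := mulr_ge0 A0 (ltW d0).
have h3 := mulr_ge0 (normr_ge0 m0) T0; have h4 := mulr_ge0 (normr_ge0 m0) (ltW d0).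
by lra.
Qed.

Lemma cgf0 (R : realType) (p0 : R -> R) : is_density p0 -> cgf p0 0 = 0.
Proof.
move=> [_ _ p01]; rewrite /cgf /mgf.
under eq_integral do rewrite mul0r expR0 mul1r.
by rewrite p01 ln1.
Qed.

Lemma Theta_shift (R : realType) (lo hi : \bar R) (tmin tmax delta : R) :
    Theta lo hi tmin -> Theta lo hi tmax -> tmin <= tmax -> 0 < delta ->
    (delta%:E < (5^-1)%:E * Order.min (tmin%:E - lo) (hi - tmax%:E))%E ->
  Theta lo hi (tmin - 3 * delta) /\ Theta lo hi (tmax + 3 * delta).
Proof.
move=> /andP[lomin minhi] /andP[lomax maxhi] tt d0.
rewrite lte_pdivlMl// lt_min => /andP[h1 h2].
have l1 : (lo < (tmin - 3 * delta)%:E)%E.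
  move: lomin h1; case: lo {lomax} => [l lmin|//|_ _]; last exact: ltNyr.
  by rewrite -EFinM -EFinB !lte_fin; lra.
have l2 : ((tmax + 3 * delta)%:E < hi)%E.
  move: maxhi h2; case: hi {minhi} => [u umax|_ _|//]; last exact: ltry.
  by rewrite -EFinM -EFinB !lte_fin; lra.
split; apply/andP; split => //.
  by rewrite (le_lt_trans _ minhi)// lee_fin; lra.
by rewrite (lt_le_trans lomax)// lee_fin; lra.
Qed.

Theorem theorem3 (R : realType) (p0 : R -> R) (lo hi : \bar R)
    (hp0 : is_density p0)
    (h0 : (lo < 0 < hi)%E)
    (hmgf : forall t : R, Theta lo hi t -> (mgf p0 t < +oo)%E)
    (n : nat) (hn : (0 < n)%N) (x : 'I_n -> R) (hx : forall i, 0 < p0 (x i))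
    (pihat : probability (measurableTypeR R) R) (hpi : is_npmle p0 lo hi x pihat)
    (xmin xmax : R) (hxmin : forall i, xmin <= x i) (hxmax : forall i, x i <= xmax)
    (tmin tmax : R)
    (htmin : Theta lo hi tmin) (hmutmin : mean_map p0 tmin = xmin)
    (htmax : Theta lo hi tmax) (hmutmax : mean_map p0 tmax = xmax)
    (hmu0 : xmin <= mean_map p0 0 <= xmax)
    (delta : R) (hdelta0 : 0 < delta)
    (hdelta : (delta%:E < (5^-1)%:E * Order.min (tmin%:E - lo) (hi - tmax%:E))%E) :
  let r := (tmax - tmin) / 2 in
  let a := (xmax - xmin) / 2 in
  let x0 := (xmax + xmin) / 2 in
  let tau := Num.max (mean_map p0 (tmax + delta) - xmax)
                     (xmin - mean_map p0 (tmin - delta)) in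
  let tabs := Num.max tmax (- tmin) in
  let xabs := Num.max xmax (- xmin) in
  let kappa_max := Num.max (cgf p0 (tmin - 3 * delta)) (cgf p0 (tmax + 3 * delta)) in
  let N1 := 2 * (a + `|mean_map p0 0| + `|x0|) * (tabs + 2 * delta)
            + kappa_max + ln ((xabs + 1 / delta) / tau) in
  finite_set (supp pihat) /\
  (#|` fset_set (supp pihat)|)%:R
    <= N1 / ln ((2 * r + 2 * delta) / (2 * r + delta)).
Proof.
move=> r a x0 tau tabs xabs kappa_max N1.
have /andP[xmin0 xmax0] := hmu0.
have hT0 : Theta lo hi 0 by [].
have tmin0 : tmin <= 0.
  rewrite leNgt; apply/negP => /(mean_map_lt hp0 hmgf hT0 htmin).
  by rewrite hmutmin => /(le_lt_trans xmin0); rewrite ltxx.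
have tmax0 : 0 <= tmax.
  rewrite leNgt; apply/negP => /(mean_map_lt hp0 hmgf htmax hT0).
  by rewrite hmutmax => /lt_le_trans/(_ xmax0); rewrite ltxx.
have [hmin3 hmax3] := Theta_shift htmin htmax (le_trans tmin0 tmax0) hdelta0 hdelta.
have hmin1 : Theta lo hi (tmin - delta).
  by apply: (Theta_convex hmin3 htmin); clear - hdelta0; apply/andP; split; lra.
have hmax1 : Theta lo hi (tmax + delta).
  by apply: (Theta_convex htmax hmax3); clear - hdelta0; apply/andP; split; lra.
have taumax : 0 < mean_map p0 (tmax + delta) - xmax.
  rewrite subr_gt0 -hmutmax; apply: (mean_map_lt hp0 hmgf htmax hmax1).
  by rewrite ltrDl.
have taumin : 0 < xmin - mean_map p0 (tmin - delta).
  rewrite subr_gt0 -hmutmin; apply: (mean_map_lt hp0 hmgf hmin1 htmin).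
  by rewrite gtrBl.
have xm i : mean_map p0 tmin <= x i <= mean_map p0 tmax.
  by rewrite hmutmin hmutmax hxmin hxmax.
have [w [w0 Sle neg]] := npmle_optimality hp0 hmgf htmin htmax hn hx xm hpi.
have contact := supp_contact hp0 hmgf hn w0 Sle htmin htmax xm hpi.1 neg.
have contact' := expsum'_eq hp0 hmgf Sle.
have w0' i : 0 <= w i by exact: ltW.
have xabs0 : 0 <= xabs.
  rewrite /xabs le_max; have [|xm0] := leP 0 xmax => //=.
  by rewrite oppr_ge0 (le_trans xmin0)// (le_trans xmax0)// ltW.
have r0 : 0 <= r by rewrite divr_ge0// subr_ge0 (le_trans tmin0).
have r2 : 2 * r = tmax - tmin by rewrite /r; clear; lra.
have xx : xmin <= xmax := le_trans xmin0 xmax0.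
have kmin : cgf p0 (tmin - 3 * delta) <= kappa_max by rewrite le_max lexx.
have kmax : cgf p0 (tmax + 3 * delta) <= kappa_max by rewrite le_max lexx orbT.
have tmaxT : `|tmax| <= tabs by rewrite ger0_norm// le_max lexx.
have tminT : `|tmin| <= tabs by rewrite ler0_norm// le_max lexx orbT.
have xmaxa : `|xmax| <= a + `|x0|.
  have -> : xmax = a + x0 by rewrite /a /x0; clear; lra.
  by rewrite (le_trans (ler_normD _ _))// lerD2r ger0_norm// divr_ge0// subr_ge0.
have xmina : `|xmin| <= a + `|x0|.
  have -> : xmin = - a + x0 by rewrite /a /x0; clear; lra.
  by rewrite (le_trans (ler_normD _ _))// lerD2r normrN ger0_norm// divr_ge0// subr_ge0.
have tangent t : Theta lo hi t -> mean_map p0 0 * t <= cgf p0 t.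
  by move=> /(cgf_tangent_le hp0 hmgf hT0); rewrite cgf0// add0r subr0.
pose ell := ln ((2 * r + 2 * delta) / (2 * r + delta)).
(* Stated for arbitrary finite lists of distinct support points, so that it yields finiteness of the
   support as well as the count. The case split selects the end at which the maximum [tau] is
   attained. *)
have bound (bs : seq R) : uniq bs -> (forall t, t \in bs -> supp pihat t) ->
    (size bs)%:R * ell <= N1.
  move=> ubs hbs; rewrite /N1 /tau.
  have hTh t : t \in bs ->
      [/\ Theta lo hi t, tmin <= t <= tmax & expsum x w t = rmgf p0 t].
    move=> /hbs/contact[tI e]; split => //; exact: (Theta_convex htmin htmax tI).
  have [AB|AB] := leP (mean_map p0 (tmax + delta) - xmax)
                      (xmin - mean_map p0 (tmin - delta)).
    have e1 : tmin + -1 * delta = tmin - delta by rewrite mulN1r.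
    have e3 : tmin + -1 * (3 * delta) = tmin - 3 * delta by rewrite mulN1r.
    have et : -1 * (mean_map p0 (tmin + -1 * delta) - xmin) =
        xmin - mean_map p0 (tmin - delta).
      by rewrite e1 mulN1r opprB.
    have := @one_sided_bound R p0 hp0 lo hi hmgf n x w w0' Sle contact'
      (-1) xmax xmin tmin delta r.
    rewrite et e1 e3; move=> H.
    apply: le_trans (H _ _ _ _ _ _ _ _ _ bs ubs _) _ => //.
    - by rewrite mulrNN mulr1.
    - by move=> i; rewrite mulN1r oppr_ge0 subr_le0.
    - by move=> i; rewrite mulN1r oppr_le0 subr_ge0.
    - by rewrite mulN1r oppr_ge0 subr_le0.
    - move=> t /hTh[h1 /andP[h2 h3] h4]; split => //; rewrite r2.
      by clear - h2 h3; apply/andP; split; lra.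
    - apply: (budget_ge (te := tmin)) => //; first by rewrite e1; exact: tangent.
      by rewrite normrN1.
  have et : 1 * (mean_map p0 (tmax + 1 * delta) - xmax) =
      mean_map p0 (tmax + delta) - xmax.
    by rewrite !mul1r.
  have := @one_sided_bound R p0 hp0 lo hi hmgf n x w w0' Sle contact'
    1 xmin xmax tmax delta r.
  rewrite et !(mul1r delta) (mul1r (3 * delta)); move=> H.
  apply: le_trans (H _ _ _ _ _ _ _ _ _ bs ubs _) _ => //.
  - by rewrite mulr1.
  - by move=> i; rewrite mul1r subr_ge0.
  - by move=> i; rewrite mul1r subr_le0.
  - by rewrite mul1r subr_ge0.
  - move=> t /hTh[h1 /andP[h2 h3] h4]; split => //; rewrite r2.
      by clear - h2 h3; apply/andP; split; lra.
  - have B : mean_map p0 0 * (tmax + 1 * delta) <= cgf p0 (tmax + delta).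
      by rewrite mul1r; exact: tangent.
    have := budget_ge kmax B (normr1 _) tmaxT xmina hdelta0 taumax xabs0.
    by rewrite (mul1r delta).
have ell0 : 0 < ell.
  by rewrite ln_gt0//; clear - r0 hdelta0; rewrite ltr_pdivlMr ?mul1r; lra.
(* The empty list already shows that [N1] is nonnegative, as the Archimedean bound on [N1 / ell]
   requires. *)
have N10 : 0 <= N1 by have := bound [::] isT; rewrite mul0r; apply.
have fin : finite_set (supp pihat).
  apply: contrapT => /(infinite_set_fset (Num.bound (N1 / ell)))[B Bs].
  rewrite -(ler_nat R) => /(lt_le_trans (archi_boundP (divr_ge0 N10 (ltW ell0)))).
  rewrite ltr_pdivrMr//; apply/negP; rewrite -leNgt; apply: bound; first exact: fset_uniq.
  by move=> t tB; exact: Bs.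
split => //; rewrite ler_pdivlMr//; apply: bound; first exact: fset_uniq.
by move=> t; rewrite in_fset_set// => /set_mem.
Qed.
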